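(* Let $\mathcal{D}=(\Delta_0\times\Delta_1,\mathcal{B})$ be the design constructed from $\mathcal{D}_0,\mathcal{D}_1,\mathcal{D}_2,(\psi_\beta)_{\beta\in\mathcal{L}_1}$ as described in the context. Then the group $G=\mathrm{Aut}(\mathcal{D})\cap(\mathrm{Sym}(\Delta_0)\wr\mathrm{Sym}(\Delta_1))$ is equal to the set of all elements $g=(h_1,\dots,h_{v_1})\sigma$ of $\mathrm{Sym}(\Delta_0)\wr\mathrm{Sym}(\Delta_1)$ such that each $h_j\in\mathrm{Aut}^*(\mathcal{D}_0)$, $\sigma\in\mathrm{Aut}(\mathcal{D}_1)$, and the following property holds: for all $\beta\in\mathcal{L}_1$ and all $\gamma\in\mathcal{L}_2$, the set $$\gamma'_{\gamma,\beta,g}:=\{(\gamma\cap\psi_\beta^{-1}(j))^{h_j}\mid j\in\beta\text{ such that }\gamma\cap\psi_\beta^{-1}(j)\neq\emptyset\}$$ belongs to $\mathcal{L}_2$, and moreover $\gamma'_{\gamma,\beta,g}\cap\psi_{\beta^\sigma}^{-1}(j^\sigma)=(\gamma\cap\psi_\beta^{-1}(j))^{h_j}$ for all $j\in\beta$.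
   Context: Input data: 1. $\mathcal{D}_0=(\Delta_0,\mathcal{L}_0)$ is a resolvable $2$-$(v_0,k_0,\lambda_0)$ design: its block set $\mathcal{L}_0$ is partitioned into a set $\mathcal{P}_0=\{P_1,\dots,P_r\}$ of $r$ parallel classes, each $P_i$ consisting of $s$ blocks that partition the point set $\Delta_0$. So $v_0=sk_0$ and $(v_0-1)\lambda_0=r(k_0-1)$. 2. $\mathcal{D}_1=(\Delta_1,\mathcal{L}_1)$ is a symmetric $2$-$(v_1,r,\lambda_1)$ design (blocks of size $r$; degenerate cases such as the $2$-$(v_1,v_1-1,v_1-2)$ design are allowed), so $(v_1-1)\lambda_1=r(r-1)$; its points are labelled $1,\dots,v_1$; together with bijections $\psi_\beta:\mathcal{P}_0\to\beta$ for $\beta\in\mathcal{L}_1$, such that for each $P\in\mathcal{P}_0$ and $i\in\Delta_1$ there is a unique $\beta\in\mathcal{L}_1$ with $\psi_\beta(P)=i$. 3. $\mathcal{D}_2=(\Delta_2,\mathcal{L}_2)$ is a transversal design: its point set is $\Delta_2=\bigcup_{P\in\mathcal{P}_0}P$ $(=\mathcal{L}_0)$, partitioned into $r$ ''groups'' of size $s$, namely the parallel classes $P\in\mathcal{P}_0$; each block has size $k_2\le r$ and meets each group in at most one point; and any two points in different groups lie in exactly $\lambda_2$ blocks. There are $b_2$ blocks and each point lies in $r_2$ blocks, where $r_2=\frac{(r-1)s\lambda_2}{k_2-1}$ and $b_2=\frac{r(r-1)s^2\lambda_2}{k_2(k_2-1)}$. Construction: for $\gamma\in\mathcal{L}_2$,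 $\beta\in\mathcal{L}_1$ and $j\in\beta$, the intersection $\gamma\cap\psi_\beta^{-1}(j)$ is either empty or a single block of the parallel class $\psi_\beta^{-1}(j)$; in the latter case it is identified with that block, regarded (as appropriate) as an element of $\Delta_2=\mathcal{L}_0$ or as a subset of $\Delta_0$. Put $$B_\beta(\gamma):=\bigcup_{j\in\beta}\big((\gamma\cap\psi_\beta^{-1}(j))\times\{j\}\big)\subseteq\Delta_0\times\Delta_1 .$$ The design $\mathcal{D}=(\Delta_0\times\Delta_1,\mathcal{B})$ has point set $\Delta_0\times\Delta_1$ and block set $\mathcal{B}$ equal to the disjoint union over $\beta\in\mathcal{L}_1$ of the sets $\mathcal{B}_\beta=\{B_\beta(\gamma)\mid\gamma\in\mathcal{L}_2\}$. Automorphisms: an automorphism of a design is a permutation of its points leaving its block set invariant. Permutations act on the right, written exponentially. $G$ is the group of all automorphisms of $\mathcal{D}$ leaving invariant the partition $\{\Delta_0\times\{i\}\mid i\in\Delta_1\}$ of the point set; a typical element of $\mathrm{Sym}(\Delta_0)\wr\mathrm{Sym}(\Delta_1)$ is $g=(h_1,\dots,h_{v_1})\sigma$ with $h_i\in\mathrm{Sym}(\Delta_0)$, $\sigma\in\mathrm{Sym}(\Delta_1)$, acting by $(\delta,j)^g=(\delta^{h_j},j^\sigma)$. For $\beta\subseteq\Delta_1$, $\beta^\sigma=\{j^\sigma\mid j\in\beta\}$. $\mathrm{Aut}^*(\mathcal{D}_0)$ is the subgroup of $\mathrm{Aut}(\mathcal{D}_0)$ preserving the set $\mathcal{P}_0$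 of parallel classes. *)

(* Defs.v *)
From mathcomp Require Import all_boot all_fingroup.

Set Implicit Arguments.
Unset Strict Implicit.
Unset Printing Implicit Defensive.

Local Open Scope group_scope.

(* A design is given by its set of blocks, so it has no repeated blocks.      *)

(* No nondegeneracy condition (such as 1 < k or 0 < lambda) is imposed.       *)
Definition two_design (T : finType) (L : {set {set T}}) (v k lambda : nat) :
    Prop :=
  [/\ #|T| = v,
      forall B, B \in L -> #|B| = k
    & forall x y : T, x != y ->
        #|[set B in L | (x \in B) && (y \in B)]| = lambda].

Definition symmetric_design (T : finType) (L : {set {set T}})
    (v k lambda : nat) : Prop :=
  two_design L v k lambda /\ #|L| = v.

Definition resolution (T : finType) (L : {set {set T}})
    (P0 : {set {set {set T}}}) (r s : nat) : Prop :=
  [/\ partition P0 L,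
      #|P0| = r
    & forall P, P \in P0 -> partition P [set: T] /\ #|P| = s].

(* The points are the elements of X, and Gs is the set of groups.  The        *)
(* replication number (r-1)s*lambda/(k-1) presupposes 1 < k, and 0 < lambda   *)
(* excludes the empty block set.                                              *)
Definition transversal_design (T : finType) (X : {set T})
    (Gs L : {set {set T}}) (r s k lambda : nat) : Prop :=
  [/\ [/\ partition Gs X, #|Gs| = r & forall Q, Q \in Gs -> #|Q| = s],
      [/\ 1 < k, k <= r & 0 < lambda],
      forall C, C \in L ->
        [/\ C \subset X, #|C| = k & forall Q, Q \in Gs -> #|C :&: Q| <= 1]
    & forall x y Q Q', Q \in Gs -> Q' \in Gs -> Q != Q' ->
        x \in Q -> y \in Q' ->
        #|[set C in L | (x \in C) && (y \in C)]| = lambda].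

(* Only the values psi b P with b \in L1 and P \in P0 are relevant.           *)
Definition labelling (T0 T1 : finType) (P0 : {set {set {set T0}}})
    (L1 : {set {set T1}}) (psi : {set T1} -> {set {set T0}} -> T1) : Prop :=
  (forall b, b \in L1 -> {in P0 &, injective (psi b)} /\ psi b @: P0 = b) /\
  (forall P i, P \in P0 -> exists! b, b \in L1 /\ psi b P = i).

(* The parallel class psi_b^-1(j); the default set0 is not reached under      *)
(* labelling P0 L1 psi when b \in L1 and j \in b.                             *)
Definition psi_inv (T0 T1 : finType) (P0 : {set {set {set T0}}})
    (psi : {set T1} -> {set {set T0}} -> T1) (b : {set T1}) (j : T1) :
    {set {set T0}} :=
  odflt set0 [pick P in P0 | psi b P == j].

(* The set c :&: psi_inv P0 psi b j contains at most one element of L0; the   *)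
(* corresponding subset of T0 is its cover (set0 if there is no element).     *)
Definition block_of (T0 T1 : finType) (P0 : {set {set {set T0}}})
    (psi : {set T1} -> {set {set T0}} -> T1) (b : {set T1})
    (c : {set {set T0}}) : {set T0 * T1} :=
  \bigcup_(j in b) setX (cover (c :&: psi_inv P0 psi b j)) [set j].

Definition design_blocks (T0 T1 : finType) (P0 : {set {set {set T0}}})
    (L1 : {set {set T1}}) (L2 : {set {set {set T0}}})
    (psi : {set T1} -> {set {set T0}} -> T1) : {set {set T0 * T1}} :=
  \bigcup_(b in L1) [set block_of P0 psi b c | c in L2].

Definition design_Aut (T : finType) (L : {set {set T}}) : {set {perm T}} :=
  'N(L | 'P^* ).

Definition design_Aut_star (T : finType) (L : {set {set T}})
    (P0 : {set {set {set T}}}) : {set {perm T}} :=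
  'N_(design_Aut L)(P0 | ('P^* )^* ).

Definition wreath_fun (T0 T1 : finType) (h : {ffun T1 -> {perm T0}})
    (sigma : {perm T1}) (x : T0 * T1) : T0 * T1 :=
  (h x.2 x.1, sigma x.2).

Fact wreath_fun_inj (T0 T1 : finType) (h : {ffun T1 -> {perm T0}})
  (sigma : {perm T1}) : injective (wreath_fun h sigma).
Proof.
by move=> [x i] [y j] [] /[swap] /perm_inj /= -> /perm_inj ->.
Qed.

Definition wreath_perm (T0 T1 : finType) (h : {ffun T1 -> {perm T0}})
    (sigma : {perm T1}) : {perm T0 * T1} :=
  perm (@wreath_fun_inj T0 T1 h sigma).

Definition wreath_Sym (T0 T1 : finType) : {set {perm T0 * T1}} :=
  [set wreath_perm h sigma |
    h : {ffun T1 -> {perm T0}}, sigma : {perm T1}].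

(* The set gamma'_{c,b,g} for g = wreath_perm h sigma.                        *)
Definition gamma' (T0 T1 : finType) (P0 : {set {set {set T0}}})
    (psi : {set T1} -> {set {set T0}} -> T1) (h : {ffun T1 -> {perm T0}})
    (b : {set T1}) (c : {set {set T0}}) : {set {set T0}} :=
  [set h j @: cover (c :&: psi_inv P0 psi b j) |
    j in b & c :&: psi_inv P0 psi b j != set0].

(* Main.v *)
(* A nonempty slice a x {j} of a block B_beta(gamma) determines beta, by the
   uniqueness of beta with psi_beta(P) = j where a lies in P.  Two blocks gamma,
   gamma' of the transversal design are always met by a common third one, so
   all images B_beta(gamma)^g for a fixed beta belong to the same beta', and
   beta' = beta^sigma.  Hence h_j sends the class psi_beta^-1(j) into the class
   psi_beta'^-1(j^sigma), and comparing slices gives the rest. *)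
Require Import Defs.
From mathcomp Require Import all_boot all_fingroup.

Set Implicit Arguments.
Unset Strict Implicit.
Unset Printing Implicit Defensive.

Local Open Scope group_scope.

(** * Stabilizers of block sets, and slices of subsets of the product *)

(** One inclusion suffices: a permutation mapping a finite set of blocks into itself maps it onto
    itself. *)
Lemma design_AutP (T : finType) (L : {set {set T}}) (g : {perm T}) :
  reflect (forall B, B \in L -> g @: B \in L) (g \in design_Aut L).
Proof.
rewrite /design_Aut !inE /=; apply: (iffP subsetP) => H B LB.
  by have := H B LB; rewrite inE /= setactE.
by rewrite inE /= setactE; apply: H.
Qed.

Lemma design_Aut_starP (T : finType) (L : {set {set T}})
    (P0 : {set {set {set T}}}) (g : {perm T}) :
  reflect ((forall B, B \in L -> g @: B \in L) /\
           (forall P, P \in P0 -> [set g @: (a : {set T}) | a in P] \in P0))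
          (g \in design_Aut_star L P0).
Proof.
rewrite /design_Aut_star in_setI; apply: (iffP andP) => -[/design_AutP gL gP];
  split=> //.
  move=> P P0P; move: gP; rewrite !inE => /andP[_ /subsetP/(_ P P0P)].
  by rewrite inE /= setactE.
rewrite !inE /=; apply/subsetP => P P0P; rewrite inE /= setactE.
exact: gP.
Qed.

Definition slice (T0 T1 : finType) (X : {set T0 * T1}) (j : T1) : {set T0} :=
  [set x | (x, j) \in X].

Lemma sliceP (T0 T1 : finType) (X Y : {set T0 * T1}) :
  (forall j, slice X j = slice Y j) -> X = Y.
Proof.
by move=> eqXY; apply/setP => -[x j]; have /setP/(_ x) := eqXY j; rewrite !inE.
Qed.

Lemma slice_wreath (T0 T1 : finType) (h : {ffun T1 -> {perm T0}})
    (sigma : {perm T1}) (X : {set T0 * T1}) (j : T1) :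
  slice (wreath_perm h sigma @: X) (sigma j) = h j @: slice X j.
Proof.
apply/setP => y; rewrite inE; apply/imsetP/imsetP => [[[x i] Xxi]|[x]].
  by rewrite permE => -[-> /perm_inj ->]; exists x; rewrite ?inE.
by rewrite inE => Xxj ->; exists (x, j); rewrite ?permE.
Qed.

Lemma slice_block_of (T0 T1 : finType) (P0 : {set {set {set T0}}})
    (psi : {set T1} -> {set {set T0}} -> T1) b c j :
  slice (block_of P0 psi b c) j =
  if j \in b then cover (c :&: psi_inv P0 psi b j) else set0.
Proof.
apply/setP => x; rewrite inE; apply/bigcupP/idP => [[i bi]|].
  by rewrite !inE /= => /andP[cx /eqP->]; rewrite bi.
case: ifP => [bj cx|]; last by rewrite inE.
by exists j; rewrite // !inE /= cx eqxx.
Qed.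

(** Reconciles the two readings of a block, as an element of [L0] and as a subset of [T0], under the
    action of a permutation. *)
Lemma cover_imset (T : finType) (g : {perm T}) (A : {set {set T}}) :
  cover [set g @: (a : {set T}) | a in A] = g @: cover A.
Proof.
apply/setP => y; apply/bigcupP/imsetP => [[_ /imsetP[a Aa ->]]|].
  by case/imsetP=> x ax ->; exists x => //; apply/bigcupP; exists a.
case=> x /bigcupP[a Aa ax] ->; exists (g @: a); first exact: imset_f.
exact: imset_f.
Qed.

(** * Incidence in the labelled classes and in the transversal design *)

Section Construction.

Context (T0 T1 : finType) (r s v1 lambda1 k2 lambda2 : nat)
  (L0 : {set {set T0}}) (P0 : {set {set {set T0}}})
  (L1 : {set {set T1}}) (L2 : {set {set {set T0}}})
  (psi : {set T1} -> {set {set T0}} -> T1)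
  (hP0 : resolution L0 P0 r s)
  (hD1 : symmetric_design L1 v1 r lambda1)
  (hpsi : labelling P0 L1 psi)
  (hD2 : transversal_design L0 P0 L2 r s k2 lambda2).

Local Notation blk := (block_of P0 psi).
Local Notation pinv := (psi_inv P0 psi).

Lemma card_classes_gt1 : 1 < #|P0|.
Proof.
by case: hP0 => _ -> _; case: hD2 => _ [k2gt1 k2r _] _ _; apply: leq_trans k2r.
Qed.

Lemma class_uniq P Q a : P \in P0 -> Q \in P0 -> a \in P -> a \in Q -> P = Q.
Proof.
case: hP0 => /and3P[_ tI _] _ _ P0P P0Q Pa Qa.
by rewrite -(def_pblock tI P0P Pa) (def_pblock tI P0Q Qa).
Qed.

Lemma class_exists a : a \in L0 -> exists2 P, P \in P0 & a \in P.
Proof.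
case: hP0 => /and3P[/eqP <- _ _] _ _ /bigcupP[P P0P Pa].
by exists P.
Qed.

Lemma class_sub P a : P \in P0 -> a \in P -> a \in L0.
Proof.
case: hP0 => /and3P[/eqP <- _ _] _ _ P0P Pa; apply/bigcupP; by exists P.
Qed.

Lemma class_block_neq0 P a : P \in P0 -> a \in P -> a != set0.
Proof.
case: hP0 => _ _ hP /hP[/and3P[_ _ n0] _] Pa.
by apply: contraNneq n0 => <-.
Qed.

Lemma class_neq0 P : P \in P0 -> exists a, a \in P.
Proof.
by case: hP0 => /and3P[_ _ n0] _ _ P0P; apply/set0Pn; apply: contraNneq n0 => <-.
Qed.

Lemma labelling_uniq P b b' : P \in P0 -> b \in L1 -> b' \in L1 ->
  psi b P = psi b' P -> b = b'.
Proof.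
case: hpsi => _ uq P0P Lb Lb' e.
have [b0 [_ u0]] := uq P (psi b P) P0P.
by rewrite -(u0 b) // (u0 b').
Qed.

Lemma psi_mem b P : b \in L1 -> P \in P0 -> psi b P \in b.
Proof. by case: hpsi => H _ /H[_ {2}<-]; apply: imset_f. Qed.

Lemma psi_onto b j : b \in L1 -> j \in b -> exists2 P, P \in P0 & psi b P = j.
Proof. by case: hpsi => H _ /H[_ {1}<-] /imsetP[P]; exists P. Qed.

Lemma psi_invK b P : b \in L1 -> P \in P0 -> pinv b (psi b P) = P.
Proof.
case: hpsi => H _ /H[inj _] P0P; rewrite /psi_inv.
case: pickP => [Q /andP[P0Q /eqP/inj->]//|/(_ P)].
by rewrite P0P eqxx.
Qed.

Lemma transversal_class_exists c a : c \in L2 -> a \in c ->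
  exists2 P, P \in P0 & a \in P.
Proof.
case: hD2 => _ _ H _ /H[/subsetP sub _ _] ca.
exact/class_exists/sub.
Qed.

Lemma transversal_class c P a : c \in L2 -> P \in P0 -> a \in c -> a \in P ->
  c :&: P = [set a].
Proof.
case: hD2 => _ _ H _ /H[_ _ le1] P0P ca Pa.
by apply/eqP; rewrite eq_sym eqEcard cards1 le1 // sub1set inE ca Pa.
Qed.

Lemma transversal_join P Q a b : P \in P0 -> Q \in P0 -> P != Q ->
  a \in P -> b \in Q -> exists c, [/\ c \in L2, a \in c & b \in c].
Proof.
case: hD2 => _ [_ _ l0] _ H P0P P0Q nPQ Pa Qb.
have /eqP := H a b P Q P0P P0Q nPQ Pa Qb; rewrite eqn_leq => /andP[_].
move=> /(leq_trans l0)/card_gt0P[c]; rewrite inE => /and3P[? ? ?].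
by exists c.
Qed.

(** [c] has [k2 > 1] elements and at most one of them lies in [P]. *)
Lemma transversal_other c P : c \in L2 -> P \in P0 ->
  exists a Q, [/\ Q \in P0, Q != P, a \in c & a \in Q].
Proof.
case: hD2 => _ [k2gt1 _ _] H _ Lc P0P; have [_ ck le1] := H c Lc.
have : c :\: P != set0.
  rewrite -card_gt0 -(ltn_add2l #|c :&: P|) cardsID addn0 ck.
  exact: leq_ltn_trans (le1 P P0P) k2gt1.
case/set0Pn=> a /setDP[ca nPa].
have [Q P0Q Qa] := transversal_class_exists Lc ca.
by exists a, Q; split=> //; apply: contraNneq nPa => <-.
Qed.

(** An element of [c] in a class [Q] and an element of [c'] outside [Q] lie in different groups, so
    some block joins them. *)
Lemma transversal_link c c' : c \in L2 -> c' \in L2 ->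
  exists d a a', [/\ d \in L2, a \in c, a \in d, a' \in c' & a' \in d].
Proof.
move=> Lc Lc'.
(* [P] is arbitrary and serves only to extract an element of [c]. *)
have /card_gt0P[P P0P] := ltnW card_classes_gt1.
have [a [Q [P0Q _ ca Qa]]] := transversal_other Lc P0P.
have [a' [Q' [P0Q' nQ c'a' Q'a']]] := transversal_other Lc' P0Q.
have [d [Ld da' da]] := transversal_join P0Q' P0Q nQ Q'a' Qa.
by exists d, a, a'.
Qed.

(** Since [1 < k2 <= r] there is a second class; join [a] to any element of it. *)
Lemma transversal_point P a : P \in P0 -> a \in P ->
  exists2 c, c \in L2 & a \in c.
Proof.
move=> P0P Pa.
have : P0 :\ P != set0.
  by rewrite -card_gt0; have := card_classes_gt1; rewrite (cardsD1 P) P0P.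
case/set0Pn=> Q /setD1P[nQP P0Q]; have [b Qb] := class_neq0 P0Q.
have [c [Lc _ ca]] := transversal_join P0Q P0P nQP Qb Pa.
by exists c.
Qed.

(** As [c] meets each class at most once, a nonempty slice is exactly the element of [c] in the
    class labelled [j]. An empty slice carries no such information: it may come from [j] outside [b]
    or from [c] missing the class. *)
Lemma slice_blockP b c j a : b \in L1 -> c \in L2 -> a != set0 ->
  slice (blk b c) j = a <->
  exists P, [/\ P \in P0, psi b P = j, a \in c & a \in P].
Proof.
move=> Lb Lc a0; rewrite slice_block_of; split=> [|[P [P0P <- ca Pa]]].
  case: ifP => [bj|_ e]; last by rewrite -e eqxx in a0.
  have [P P0P <-] := psi_onto Lb bj; rewrite psi_invK // => e.
  have [c0|/set0Pn[a' /setIP[ca' Pa']]] := eqVneq (c :&: P) set0.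
    by move: a0; rewrite -e c0 /cover big_set0 eqxx.
  exists P; move: e; rewrite (transversal_class Lc P0P ca' Pa').
  by rewrite /cover big_set1 => <-.
rewrite psi_mem // psi_invK // (transversal_class Lc P0P ca Pa).
by rewrite /cover big_set1.
Qed.

(** * Consequences of [g] preserving the constructed blocks *)

Section Automorphism.

Context (h : {ffun T1 -> {perm T0}}) (sigma : {perm T1}).

Local Notation g := (wreath_perm h sigma).

Lemma wreath_image b b' c c' P a :
    b \in L1 -> b' \in L1 -> c \in L2 -> c' \in L2 ->
    g @: blk b c = blk b' c' -> P \in P0 -> a \in c -> a \in P ->
  exists Q, [/\ Q \in P0, psi b' Q = sigma (psi b P),
                h (psi b P) @: a \in c' & h (psi b P) @: a \in Q].
Proof.
move=> Lb Lb' Lc Lc' e P0P ca Pa.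
have a0 := class_block_neq0 P0P Pa.
have ha0 : h (psi b P) @: a != set0 by rewrite imset_eq0.
apply: (slice_blockP (sigma (psi b P)) Lb' Lc' ha0).1.
rewrite -e slice_wreath ((slice_blockP _ Lb Lc a0).2 _) //.
by exists P.
Qed.

(** The slice of the image over [sigma j] is the [h j]-image of the slice over [j], so the latter is
    nonempty and is the required [a]. *)
Lemma wreath_preimage b b' c c' j Q a' :
    b \in L1 -> b' \in L1 -> c \in L2 -> c' \in L2 ->
    g @: blk b c = blk b' c' ->
    Q \in P0 -> psi b' Q = sigma j -> a' \in c' -> a' \in Q ->
  exists P a, [/\ P \in P0, psi b P = j, a \in c, a \in P & a' = h j @: a].
Proof.
move=> Lb Lb' Lc Lc' e P0Q Qj c'a' Qa'.
have a'0 := class_block_neq0 P0Q Qa'.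
have e' : h j @: slice (blk b c) j = a'.
  by rewrite -(slice_wreath h sigma) e; apply: (slice_blockP _ Lb' Lc' a'0).2; exists Q.
have s0 : slice (blk b c) j != set0.
  by apply: contraNneq a'0 => s0; rewrite -e' s0 imset0.
have [P [P0P Pj ca Pa]] := (slice_blockP j Lb Lc s0).1 erefl.
by exists P, (slice (blk b c) j).
Qed.

(** The common element [a] has the same image in both blocks over the same point, so its class has
    the same label under [b1] and [b2], and the label determines the block of [L1]. *)
Lemma wreath_image_uniq b b1 b2 c1 c2 c1' c2' a :
    b \in L1 -> b1 \in L1 -> b2 \in L1 ->
    c1 \in L2 -> c2 \in L2 -> c1' \in L2 -> c2' \in L2 ->
    g @: blk b c1 = blk b1 c1' -> g @: blk b c2 = blk b2 c2' ->
    a \in c1 -> a \in c2 -> b1 = b2.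
Proof.
move=> Lb Lb1 Lb2 Lc1 Lc2 Lc1' Lc2' e1 e2 ca1 ca2.
have [P P0P Pa] : exists2 P, P \in P0 & a \in P.
  exact: transversal_class_exists Lc1 ca1.
have [Q1 [P0Q1 E1 _ Q1a]] := wreath_image Lb Lb1 Lc1 Lc1' e1 P0P ca1 Pa.
have [Q2 [P0Q2 E2 _ Q2a]] := wreath_image Lb Lb2 Lc2 Lc2' e2 P0P ca2 Pa.
have eQ := class_uniq P0Q1 P0Q2 Q1a Q2a.
by apply: (labelling_uniq P0Q1); rewrite // E1 eQ E2.
Qed.

Hypothesis gAut : g \in design_Aut (design_blocks P0 L1 L2 psi).

Lemma wreath_block b c : b \in L1 -> c \in L2 ->
  exists b' c', [/\ b' \in L1, c' \in L2 & g @: blk b c = blk b' c'].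
Proof.
move=> Lb Lc; have /design_AutP/(_ (blk b c)) := gAut.
case/(_ _)/bigcupP => [|b' Lb' /imsetP[c' Lc' ->]]; last by exists b', c'.
by apply/bigcupP; exists b => //; apply: imset_f.
Qed.

Lemma wreath_block_sigma b c : b \in L1 -> c \in L2 ->
  exists c', [/\ sigma @: b \in L1, c' \in L2
                & g @: blk b c = blk (sigma @: b) c'].
Proof.
move=> Lb Lc; have [b' [c' [Lb' Lc' e]]] := wreath_block Lb Lc.
suff -> : sigma @: b = b' by exists c'.
have [cb cb'] : #|b| = r /\ #|b'| = r.
  by case: hD1 => -[_ sz _] _; rewrite !sz.
apply/eqP; rewrite eqEcard card_imset; last exact: perm_inj.
rewrite cb cb' leqnn andbT; apply/subsetP => _ /imsetP[j bj ->].
(* If [c] misses the class labelled [j], its image says nothing about [sigma j]; hence the auxiliary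
   block [d] through an element of that class. *)
have [P P0P <-] := psi_onto Lb bj.
have [a Pa] := class_neq0 P0P; have [d Ld da] := transversal_point P0P Pa.
have [b1 [d' [Lb1 Ld' e1]]] := wreath_block Lb Ld.
suff eb : b' = b1.
  have [Q [P0Q <- _ _]] := wreath_image Lb Lb1 Ld Ld' e1 P0P da Pa.
  by rewrite eb psi_mem.
(* [f] meets both [c] and [d], so [b'] and [b1] both equal the block [b2] attached to [f]. *)
have [f [x [y [Lf cx fx dy fy]]]] := transversal_link Lc Ld.
have [b2 [f' [Lb2 Lf' e2]]] := wreath_block Lb Lf.
rewrite (wreath_image_uniq Lb Lb' Lb2 Lc Lf Lc' Lf' e e2 cx fx).
exact: wreath_image_uniq Lb Lb2 Lb1 Lf Ld Lf' Ld' e2 e1 fy dy.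
Qed.

Lemma wreath_class_mem j P a : P \in P0 -> a \in P ->
  exists b, [/\ b \in L1, psi b P = j, sigma @: b \in L1
    & h j @: a \in pinv (sigma @: b) (sigma j)].
Proof.
move=> P0P Pa; have [b [[Lb Pj] _]] := hpsi.2 P j P0P.
have [c Lc ca] := transversal_point P0P Pa.
have [c' [Lsb Lc' e]] := wreath_block_sigma Lb Lc.
exists b; split=> //.
have [Q [P0Q]] := wreath_image Lb Lsb Lc Lc' e P0P ca Pa.
by rewrite Pj => <- _ Qa; rewrite psi_invK.
Qed.

(** Classes all have [s] elements, so mapping one into another is mapping it onto that one;
    preservation of [L0] follows because the classes cover it. *)
Lemma wreath_Aut_star j : h j \in design_Aut_star L0 P0.
Proof.
have hclass P : P \in P0 -> [set h j @: (a : {set T0}) | a in P] \in P0.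
  move=> P0P; have [a Pa] := class_neq0 P0P.
  have [b [Lb Pj Lsb _]] := wreath_class_mem j P0P Pa.
  have [Q P0Q Qj] : exists2 Q, Q \in P0 & psi (sigma @: b) Q = sigma j.
    by apply: psi_onto => //; rewrite imset_f // -Pj psi_mem.
  suff -> : [set h j @: (x : {set T0}) | x in P] = Q by [].
  have [cP cQ] : #|P| = s /\ #|Q| = s.
    by case: hP0 => _ _ H; rewrite (H P P0P).2 (H Q P0Q).2.
  apply/eqP; rewrite eqEcard card_imset; last exact/imset_inj/perm_inj.
  rewrite cP cQ leqnn andbT; apply/subsetP => _ /imsetP[x Px ->].
  (* The block found for [x] is the one found for [a], since both label [P] by [j]; thus the target
     class does not depend on the element. *)
  have [b1 [Lb1 P1j _]] := wreath_class_mem j P0P Px.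
  rewrite (@labelling_uniq P b1 b) ?P1j ?Pj //.
  by rewrite -Qj psi_invK.
apply/design_Aut_starP; split=> // a La.
have [P P0P Pa] := class_exists La.
exact: class_sub (hclass P P0P) (imset_f _ Pa).
Qed.

Lemma wreath_sigma_Aut : sigma \in design_Aut L1.
Proof.
apply/design_AutP => b Lb.
(* Without a block in [L2] there would be no image from which to read [sigma]. *)
have [c Lc] : exists c, c \in L2.
  have /card_gt0P[P P0P] := ltnW card_classes_gt1.
  have [a Pa] := class_neq0 P0P; have [c Lc _] := transversal_point P0P Pa.
  by exists c.
by have [c' []] := wreath_block_sigma Lb Lc.
Qed.

Lemma gamma'_image b c c' :
    b \in L1 -> sigma @: b \in L1 -> c \in L2 -> c' \in L2 ->
    g @: blk b c = blk (sigma @: b) c' -> gamma' P0 psi h b c = c'.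
Proof.
move=> Lb Lsb Lc Lc' e; apply/setP => x; apply/imsetP/idP => [[j]|c'x].
  rewrite inE => /andP[bj]; have [P P0P <-] := psi_onto Lb bj.
  rewrite psi_invK // => /set0Pn[a /setIP[ca Pa]] ->.
  rewrite (transversal_class Lc P0P ca Pa) /cover big_set1.
  by have [Q []] := wreath_image Lb Lsb Lc Lc' e P0P ca Pa.
have [Q P0Q Qx] : exists2 Q, Q \in P0 & x \in Q.
  exact: transversal_class_exists Lc' c'x.
have /imsetP[j bj Qj] := psi_mem Lsb P0Q.
have [P [a [P0P Pj ca Pa ->]]] :=
  wreath_preimage Lb Lsb Lc Lc' e P0Q Qj c'x Qx.
exists j; rewrite ?inE -Pj psi_invK // (transversal_class Lc P0P ca Pa).
  by rewrite -cards_eq0 cards1 psi_mem.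
by rewrite /cover big_set1.
Qed.

(** Covers the empty case too: images and preimages of elements correspond, so both intersections
    are empty together. *)
Lemma gamma'_slice b c c' j :
    b \in L1 -> sigma @: b \in L1 -> c \in L2 -> c' \in L2 ->
    g @: blk b c = blk (sigma @: b) c' -> j \in b ->
  c' :&: pinv (sigma @: b) (sigma j) =
  [set h j @: (a : {set T0}) | a in c :&: pinv b j].
Proof.
move=> Lb Lsb Lc Lc' e bj.
have [Q P0Q Qj] := psi_onto Lsb (imset_f sigma bj).
apply/setP => x; rewrite -Qj psi_invK //.
apply/setIP/imsetP => [[c'x Qx]|[a]].
  have [P [a [P0P <- ca Pa ->]]] :=
    wreath_preimage Lb Lsb Lc Lc' e P0Q Qj c'x Qx.
  by exists a; rewrite // psi_invK // inE ca.
have [P P0P Pj] := psi_onto Lb bj.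
rewrite -Pj psi_invK // => /setIP[ca Pa] ->.
have [Q' [P0Q' Q'j c'a Q'a]] := wreath_image Lb Lsb Lc Lc' e P0P ca Pa.
have -> // : Q = Q'.
by rewrite -(psi_invK Lsb P0Q) Qj -Pj -Q'j psi_invK.
Qed.

End Automorphism.

End Construction.

(** * The converse inclusion and the theorem *)

Lemma wreath_block_gamma' (T0 T1 : finType) (P0 : {set {set {set T0}}})
    (psi : {set T1} -> {set {set T0}} -> T1) (h : {ffun T1 -> {perm T0}})
    (sigma : {perm T1}) (b : {set T1}) (c c' : {set {set T0}}) :
  (forall j, j \in b -> c' :&: psi_inv P0 psi (sigma @: b) (sigma j) =
     [set h j @: (a : {set T0}) | a in c :&: psi_inv P0 psi b j]) ->
  wreath_perm h sigma @: block_of P0 psi b c = block_of P0 psi (sigma @: b) c'.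
Proof.
(* Every point of [T1] is some [sigma j]; for [j] outside [b] both slices are empty. *)
move=> H; apply: sliceP => i; rewrite -(permKV sigma i); set j := sigma^-1 i.
rewrite slice_wreath !slice_block_of mem_imset; last exact: perm_inj.
by case: ifP => [/H->|_]; rewrite ?cover_imset ?imset0.
Qed.

Theorem lemma5p2 (T0 T1 : finType)
    (v0 k0 lambda0 r s v1 lambda1 k2 lambda2 : nat)
    (L0 : {set {set T0}}) (P0 : {set {set {set T0}}})
    (L1 : {set {set T1}}) (L2 : {set {set {set T0}}})
    (psi : {set T1} -> {set {set T0}} -> T1)
    (hD0 : two_design L0 v0 k0 lambda0)
    (hP0 : resolution L0 P0 r s)
    (hD1 : symmetric_design L1 v1 r lambda1)
    (hpsi : labelling P0 L1 psi)
    (hD2 : transversal_design L0 P0 L2 r s k2 lambda2) :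
  design_Aut (design_blocks P0 L1 L2 psi) :&: wreath_Sym T0 T1 =
  [set wreath_perm h sigma |
    h : {ffun T1 -> {perm T0}},
    sigma : {perm T1} in [set sigma : {perm T1} |
      [&& [forall j, h j \in design_Aut_star L0 P0],
          sigma \in design_Aut L1
        & [forall b in L1, [forall c in L2,
            (gamma' P0 psi h b c \in L2) &&
            [forall j in b,
              gamma' P0 psi h b c :&: psi_inv P0 psi (sigma @: b) (sigma j) ==
              [set h j @: a | a : {set T0} in c :&: psi_inv P0 psi b j]]]]]]].
Proof.
apply/setP => g; apply/setIP/imset2P => [[gAut /imset2P[h sigma _ _ Dg]]|].
  exists h sigma => //; subst g; rewrite inE; apply/and3P; split.
  - by apply/forallP => j; apply: (wreath_Aut_star hP0 hD1 hpsi hD2 gAut).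
  - exact: wreath_sigma_Aut hP0 hD1 hpsi hD2 _ _ gAut.
  apply/forall_inP => b Lb; apply/forall_inP => c Lc.
  have [c' [Lsb Lc' e]] := wreath_block_sigma hP0 hD1 hpsi hD2 gAut Lb Lc.
  rewrite (gamma'_image hP0 hpsi hD2 Lb Lsb Lc Lc' e) Lc' /=.
  apply/forall_inP => j bj; apply/eqP.
  exact: (gamma'_slice hP0 hpsi hD2 Lb Lsb Lc Lc' e bj).
case=> h sigma _; rewrite inE => /and3P[_ /design_AutP sAut /forall_inP H] ->.
split; last by apply/imset2P; exists h sigma.
apply/design_AutP => _ /bigcupP[b Lb /imsetP[c Lc ->]].
have /forall_inP/(_ c Lc)/andP[Lc' /forall_inP Hj] := H b Lb.
(* The image block is the one built from [sigma @: b] and [gamma']; the slice condition on [gamma']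
   identifies it. *)
rewrite (@wreath_block_gamma' _ _ _ _ _ _ b c (gamma' P0 psi h b c)).
  by apply/bigcupP; exists (sigma @: b); [exact: sAut | exact: imset_f].
by move=> j bj; apply/eqP/Hj.
Qed.
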